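(* Let $K$ be a nonempty compact subset of a complete Riemannian manifold $M$, let $\Phi:\mathbb{R}_{\ge0}\times M\to M$ be a smooth injective semiflow, and let $(f_t)_{t\in\mathbb{R}}$ be a family of lower semi-continuous functions $f_t:M_t:=\{p\in M: t\in\mathcal{D}^{(p)}\}\to[0,\infty]$. Then, for $T\ge 0$ and $p\in M$, the formulas $$F_T^+(p):=\sup_{t\in[0,T]\cap\mathcal{D}^{(p)}}f_t(p),\qquad F_T^-(p):=\sup_{t\in[-T,0]\cap\mathcal{D}^{(p)}}f_t(p),\qquad F_T^\pm(p):=\sup_{t\in[-T,T]\cap\mathcal{D}^{(p)}}f_t(p)$$ define, respectively, families $(F_T)_{T\ge 0}$ of lower semi-continuous functions, each defined for all $p\in M$ and pointwise monotonously increasing in $T$. Moreover, each of the functions $$F^+(p):=\sup_{T\ge0}F_T^+(p),\qquad F^-(p):=\sup_{T\ge0}F_T^-(p),\qquad F^\pm(p):=\sup_{T\ge0}F_T^\pm(p)\qquad(p\in K)$$ has at least one minimum point $p_*\in K$ (over $K$) that is also an accumulation point of the corresponding net $(x_T)_{T\ge0}$ of minimum points, where $x_T\in K$ is a minimum point of the restriction to $K$ of $F_T^+$, $F_T^-$, $F_T^\pm$, respectively.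
   Context: A smooth injective semiflow on $M$ is a smooth monoid action $\Phi:\mathbb{R}_{\ge0}\times M\to M$, $\Phi^t(p):=\Phi(t,p)$, with $\Phi^t$ injective for all $t\ge0$. For $p\in M$, $\mathcal{D}^{(p)}:=\{s-t\mid \Phi^t(\tilde p)=\Phi^s(p),\ \tilde p\in M,\ t,s\ge0\}$, a connected open subset of $\mathbb{R}$; it is the set of times for which the trajectory through $p$ is defined (with $\Phi^{-t}(p):=\tilde p$ when $\Phi^t(\tilde p)=p$). Nets indexed by $T\ge0$ use the usual order of $\mathbb{R}_{\ge 0}$; an accumulation point of $(x_T)$ is a point $x$ such that for every neighborhood $U$ of $x$ and every $T_0$ there is $T\ge T_0$ with $x_T\in U$. *)

(* Defs.v *)
From HB Require Import structures.
From mathcomp Require Import all_boot all_order all_algebra.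
From mathcomp Require Import all_classical all_reals all_analysis.

Set Implicit Arguments.
Unset Strict Implicit.
Unset Printing Implicit Defensive.

Import Order.TTheory GRing.Theory Num.Theory.
Import numFieldNormedType.Exports.

Local Open Scope classical_set_scope.
Local Open Scope ring_scope.

(** * Smooth maps between normed spaces *)

(* Meant for U open: 'D_v f is only constrained on U, but is computed from the
   values of f near each point of U. *)
Fixpoint Ck (R : realType) (V W : normedModType R) (k : nat) (U : set V)
    (f : V -> W) : Prop :=
  if k is k'.+1 then
    (forall x, U x -> differentiable f x) /\ (forall v, Ck k' U ('D_v f))
  else forall x, U x -> {for x, continuous f}.

Definition smooth (R : realType) (V W : normedModType R) (U : set V)
    (f : V -> W) : Prop :=
  forall k, Ck k U f.

(* Smoothness on an arbitrary subset A: near each of its points, f is the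
   restriction to A of a smooth map defined on an open set. *)
Definition smooth_on (R : realType) (V W : normedModType R) (A : set V)
    (f : V -> W) : Prop :=
  forall x, A x -> exists U : set V, exists h : V -> W,
    [/\ open_nbhs x U, smooth U h & forall y, A y -> U y -> f y = h y].

(** * Smooth manifolds *)

(* A homeomorphism [coord] from an open set [dom] of M onto an open set of R^n,
   with inverse [param]. Both are total functions, with irrelevant values
   outside [dom] and [coord @` dom]. *)
Record chart (R : realType) (n : nat) (M : topologicalType) := Chart {
  dom : set M;
  coord : M -> 'rV[R]_n;
  param : 'rV[R]_n -> M;
  dom_open : open dom;
  chart_img_open : open (coord @` dom);
  coordK : forall p, dom p -> param (coord p) = p;
  coord_continuous : {within dom, continuous coord};
  param_continuous : {within coord @` dom, continuous param} }.

Definition chart_img (R : realType) (n : nat) (M : topologicalType)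
    (c : chart R n M) : set 'rV[R]_n :=
  coord c @` dom c.

Definition transition (R : realType) (n : nat) (M : topologicalType)
    (c c' : chart R n M) : 'rV[R]_n -> 'rV[R]_n :=
  coord c' \o param c.

(* The atlas need not be maximal. *)
Record smooth_structure (R : realType) (n : nat) (M : topologicalType) :=
  SmoothStructure {
  manifold_hausdorff : hausdorff_space M;
  manifold_second_countable : @second_countable M;
  atlas : set (chart R n M);
  atlas_cover : forall p : M, exists c, atlas c /\ dom c p;
  atlas_compatible : forall c c', atlas c -> atlas c' ->
    smooth (coord c @` (dom c `&` dom c')) (transition c c') }.

(** * Riemannian metrics, distance and completeness *)

Definition gram_form (R : realType) (n : nat) (G : 'M[R]_n) (v w : 'rV[R]_n)
    : R :=
  (v *m G *m w^T) 0 0.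

(* The tensor field is given by its components in the charts of the atlas:
   [gram c x] is the Gram matrix of the coordinate vector fields of c at the
   point with coordinates x. *)
Record riemannian_metric (R : realType) (n : nat) (M : topologicalType)
    (S : smooth_structure R n M) := RiemannianMetric {
  gram : chart R n M -> 'rV[R]_n -> 'M[R]_n;
  gram_smooth : forall c, atlas S c -> smooth (chart_img c) (gram c);
  gram_sym : forall c x, atlas S c -> chart_img c x -> (gram c x)^T = gram c x;
  gram_posdef : forall c x v, atlas S c -> chart_img c x -> v != 0 ->
    0 < gram_form (gram c x) v v;
  gram_transition : forall c c' p v w, atlas S c -> atlas S c' ->
    dom c p -> dom c' p ->
    gram_form (gram c (coord c p)) v w =
    gram_form (gram c' (coord c' p)) ('D_v (transition c c') (coord c p))
                                     ('D_w (transition c c') (coord c p)) }.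

Definition smooth_curve (R : realType) (n : nat) (M : topologicalType)
    (S : smooth_structure R n M) (gamma : R -> M) : Prop :=
  {within `[0, 1], continuous gamma} /\
  forall c, atlas S c ->
    smooth_on (`[0, 1] `&` gamma @^-1` dom c) (coord c \o gamma).

Definition chart_at (R : realType) (n : nat) (M : topologicalType)
    (S : smooth_structure R n M) (p : M) : chart R n M :=
  projT1 (cid (atlas_cover S p)).

(* Independent of the chart chosen at [gamma t], by [gram_transition]. *)
Definition speed (R : realType) (n : nat) (M : topologicalType)
    (S : smooth_structure R n M) (g : riemannian_metric S) (gamma : R -> M)
    (t : R) : R :=
  let c := chart_at S (gamma t) in
  let v := 'D_1 (coord c \o gamma) t in
  Num.sqrt (gram_form (gram g c (coord c (gamma t))) v v).

Definition curve_length (R : realType) (n : nat) (M : topologicalType)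
    (S : smooth_structure R n M) (g : riemannian_metric S) (gamma : R -> M)
    : \bar R :=
  (\int[lebesgue_measure]_(t in `]0%R, 1%R[) (speed g gamma t)%:E)%E.

(* [joined g p q l]: there is a piecewise smooth curve of length l from p to q,
   each smooth piece being parametrized by [0, 1]. *)
Inductive joined (R : realType) (n : nat) (M : topologicalType)
    (S : smooth_structure R n M) (g : riemannian_metric S)
    : M -> M -> \bar R -> Prop :=
| joined_refl p : joined g p p 0%E
| joined_step gamma q l : smooth_curve S gamma -> joined g (gamma 1) q l ->
    joined g (gamma 0) q (curve_length g gamma + l)%E.

(* +oo between distinct connected components. *)
Definition riemannian_dist (R : realType) (n : nat) (M : topologicalType)
    (S : smooth_structure R n M) (g : riemannian_metric S) (p q : M) : \bar R :=
  ereal_inf [set l | joined g p q l].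

Definition riemannian_complete (R : realType) (n : nat) (M : topologicalType)
    (S : smooth_structure R n M) (g : riemannian_metric S) : Prop :=
  forall u : nat -> M,
    (forall e : R, 0 < e -> exists N : nat, forall i j : nat,
       (N <= i)%N -> (N <= j)%N -> (riemannian_dist g (u i) (u j) < e%:E)%E) ->
    exists p : M, forall e : R, 0 < e -> exists N : nat, forall i : nat,
       (N <= i)%N -> (riemannian_dist g (u i) p < e%:E)%E.

(** * Smooth injective semiflows *)

(* A map on R_{>=0} x M is a total function of which only the values at
   nonnegative times matter; smoothness at time 0 is that of a map on a
   manifold with boundary. *)
Definition smooth_semiflow_map (R : realType) (n : nat) (M : topologicalType)
    (S : smooth_structure R n M) (Phi : R -> M -> M) : Prop :=
  {within [set z : R * M | 0 <= z.1], continuous (fun z => Phi z.1 z.2)} /\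
  forall c c', atlas S c -> atlas S c' ->
    smooth_on [set z : R * 'rV[R]_n |
                [/\ 0 <= z.1, chart_img c z.2 & dom c' (Phi z.1 (param c z.2))]]
              (fun z => coord c' (Phi z.1 (param c z.2))).

Record smooth_injective_semiflow (R : realType) (n : nat)
    (M : topologicalType) (S : smooth_structure R n M) (Phi : R -> M -> M)
    : Prop := SmoothInjectiveSemiflow {
  semiflow_smooth : smooth_semiflow_map S Phi;
  semiflow0 : forall p, Phi 0 p = p;
  semiflowD : forall s t p, 0 <= s -> 0 <= t -> Phi (s + t) p = Phi s (Phi t p);
  semiflow_inj : forall t, 0 <= t -> injective (Phi t) }.

Definition time_domain (R : realType) (M : Type) (Phi : R -> M -> M) (p : M)
    : set R :=
  [set r | exists s t (p' : M),
     [/\ 0 <= s, 0 <= t, Phi t p' = Phi s p & r = s - t]].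

Definition space_domain (R : realType) (M : Type) (Phi : R -> M -> M) (t : R)
    : set M :=
  [set p | time_domain Phi p t].

(** * Suprema along trajectories and their minima *)

Definition F_plus (R : realType) (M : Type) (Phi : R -> M -> M)
    (f : R -> M -> \bar R) (T : R) (p : M) : \bar R :=
  ereal_sup [set f t p | t in `[0, T] `&` time_domain Phi p].

Definition F_minus (R : realType) (M : Type) (Phi : R -> M -> M)
    (f : R -> M -> \bar R) (T : R) (p : M) : \bar R :=
  ereal_sup [set f t p | t in `[- T, 0] `&` time_domain Phi p].

Definition F_plusminus (R : realType) (M : Type) (Phi : R -> M -> M)
    (f : R -> M -> \bar R) (T : R) (p : M) : \bar R :=
  ereal_sup [set f t p | t in `[- T, T] `&` time_domain Phi p].

Definition sup_over_T (R : realType) (M : Type) (F : R -> M -> \bar R) (p : M)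
    : \bar R :=
  ereal_sup [set F T p | T in `[0, +oo[].

Definition min_point (R : realType) (M : Type) (K : set M) (F : M -> \bar R)
    (p : M) : Prop :=
  K p /\ forall q, K q -> (F p <= F q)%E.

Definition accumulation_point (R : realType) (M : topologicalType) (x : R -> M)
    (p : M) : Prop :=
  forall U, nbhs p U -> forall T0, 0 <= T0 -> exists2 T, T0 <= T & U (x T).

(* Main.v *)
Require Import Defs.
From HB Require Import structures.
From mathcomp Require Import all_boot all_order all_algebra.
From mathcomp Require Import all_classical all_reals all_analysis.
From mathcomp Require Import ring lra.
Import Defs.

Set Implicit Arguments.
Unset Strict Implicit.
Unset Printing Implicit Defensive.

Import Order.TTheory GRing.Theory Num.Theory.
Import numFieldNormedType.Exports.

Local Open Scope classical_set_scope.
Local Open Scope ring_scope.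

(** Since the sets M_t are open, the suprema F_T are lower semicontinuous: if
    F_T(p) > a then f_t(p) > a for a single t, and this persists near p. So the
    crux is that M_t is open.

    For t >= 0, M_t is all of M. For t < 0, injectivity identifies M_t with the
    image of Phi^(-t), so it suffices that each Phi^s is an open map. For small
    s this is the inverse function theorem in its quantitative form. In a chart
    around p the flow extends to a C^1 map h(s, x) with h(0, x) = x, so on a
    neighbourhood of (0, p) the map h(s, .) - id is 1/2-Lipschitz, and a
    1/2-Lipschitz perturbation of the identity is open
    ([lipschitz_perturbation_open_at]). The neighbourhood and the time bound are
    uniform ([semiflow_open_at_small_time]), and the flow law composes open
    maps: openness at a point thus propagates along its trajectory to all times
    ([semiflow_open_at], [space_domain_open]).

    The minima are then compactness arguments. Each F_T attains its minimum on K
    ([lower_semicontinuous_min]). If p is a cluster point in K of the minimum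
    points x_T and F(q) < F(p) for some q in K, F being the supremum of the F_T,
    pick a real a strictly between; F_T0 > a near p for some T0, and x_T is near
    p for some T >= T0, so that F_T(x_T) >= F_T0(x_T) > a > F(q) >= F_T(q), which
    contradicts the choice of x_T ([min_point_sup_accumulation]). *)

(** * Lower semicontinuous functions and their minima on compact sets *)

(** At each point only the members of the family defined there contribute to
    the supremum; openness of the domains keeps a contributing member
    contributing at all nearby points. *)
Lemma lower_semicontinuous_sup (R : realType) (M : topologicalType) (I : Type)
    (J : set I) (D : I -> set M) (f : I -> M -> \bar R) :
  (forall i, open (D i)) ->
  (forall i, @lower_semicontinuous (subspace (D i)) R (f i)) ->
  lower_semicontinuous
    (fun p => ereal_sup [set f i p | i in J `&` [set i | D i p]]).
Proof.
move=> D_open f_lsc p a /ereal_sup_gt[_ [i [Ji Dip] <-]] /f_lsc[V + Va].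
rewrite -nbhs_subspace_interior => [pV|]; last exact: open_nbhs_nbhs.
exists (V `&` D i); first by apply: filterI => //; exact: open_nbhs_nbhs.
move=> q [/Va afq Diq]; apply: (lt_le_trans afq).
by apply: ereal_sup_ubound; exists i.
Qed.

Lemma ex_fin_between (R : realType) (a b : \bar R) :
  (0 <= a)%E -> (a < b)%E -> exists r : R, (a < r%:E)%E /\ (r%:E < b)%E.
Proof.
case: a => [a| |] //; case: b => [b| |] // _.
- rewrite lte_fin => ab; exists ((a + b) / 2); rewrite !lte_fin; split; lra.
- by move=> _; exists (a + 1); rewrite lte_fin ltry; split => //; lra.
Qed.

(** The sublevel sets of F at the points of K are nested, hence generate a
    filter; any of its cluster points is a minimum, since a superlevel set
    around it would miss some sublevel set. *)
Lemma lower_semicontinuous_min (R : realType) (M : topologicalType) (K : set M)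
    (F : M -> \bar R) :
  K !=set0 -> compact K -> lower_semicontinuous F ->
  (forall p, (0 <= F p)%E) -> exists p, min_point K F p.
Proof.
move=> K0 Kc Flsc F0.
pose B (q : M) := K `&` [set p | (F p <= F q)%E].
have FB : ProperFilter (filter_from K B).
  apply: filter_from_proper; last by move=> q Kq; exists q; split => /=.
  apply: filter_from_filter => // q1 q2 Kq1 Kq2.
  have [le12|/ltW le21] := leP (F q1) (F q2).
    exists q1 => // p [Kp pq1]; split; split => //=.
    exact: le_trans le12.
  exists q2 => // p [Kp pq2]; split; split => //=.
  exact: le_trans le21.
have BK : filter_from K B K.
  by case: K0 => q Kq; exists q => // p [].
have [p [Kp clp]] := Kc _ FB BK.
exists p; split => // q Kq; rewrite leNgt; apply/negP => qp.
have [a [qa /Flsc[V pV Va]]] := ex_fin_between (F0 q) qp.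
have Bq : filter_from K B (B q) by exists q.
have [p' [[Kp' p'q] Vp']] := clp (B q) V Bq pV.
by have := lt_trans (lt_le_trans (Va _ Vp') p'q) qa; rewrite ltxx.
Qed.

(** Compactness yields a cluster point of the net x, and every cluster point
    is a minimum point of the supremum: monotonicity in T turns a lower bound
    for one F_T0 near the cluster point into one for F_T at x_T. *)
Lemma min_point_sup_accumulation (R : realType) (M : topologicalType)
    (K : set M) (F : R -> M -> \bar R) (x : R -> M) :
  compact K ->
  (forall T, 0 <= T -> lower_semicontinuous (F T)) ->
  (forall T p, 0 <= T -> (0 <= F T p)%E) ->
  (forall T T' p, 0 <= T -> T <= T' -> (F T p <= F T' p)%E) ->
  (forall T, 0 <= T -> min_point K (F T) (x T)) ->
  exists p, min_point K (sup_over_T F) p /\ accumulation_point x p.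
Proof.
move=> Kc Flsc F0 Fmono xmin.
have xK : (x @ +oo) K.
  have : \forall T \near +oo, 0 <= T :> R by exact: nbhs_pinfty_ge (num_real _).
  by apply: filterS => T /xmin[].
have [p [Kp clp]] := Kc _ (fmap_proper_filter _ _) xK.
have accp : accumulation_point x p.
  move=> U pU T0 T0_ge0.
  have tail : (x @ +oo) [set x T | T in [set T | T0 <= T]].
    have : \forall T \near +oo, T0 <= T :> R.
      exact: nbhs_pinfty_ge (num_real _).
    by apply: filterS => T /= T0T; exists T.
  have [y [[T /= T0T xTy] Uy]] := clp _ _ tail pU.
  move: Uy; rewrite -xTy => UxT.
  by exists T.
exists p; split=> //; split=> // q Kq; rewrite leNgt; apply/negP => qp.
have FTq T : 0 <= T -> (F T q <= sup_over_T F q)%E.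
  by move=> T0; apply: ereal_sup_ubound; exists T; rewrite //= in_itv /= T0.
have supF0 : (0 <= sup_over_T F q)%E.
  exact: le_trans (F0 0 q (lexx _)) (FTq 0 (lexx _)).
have [a [qa /ereal_sup_gt]] := ex_fin_between supF0 qp.
move=> [_ [T0 + <-]]; rewrite /= in_itv /= andbT.
move=> T0_ge0 /(Flsc _ T0_ge0)[V pV Va].
have [T T0T VxT] := accp V pV T0 T0_ge0.
have T_ge0 := le_trans T0_ge0 T0T.
have [_ /(_ q Kq) xq] := xmin T T_ge0.
have := lt_le_trans (Va _ VxT) (Fmono _ _ _ T0_ge0 T0T).
move=> /lt_le_trans /(_ xq) /lt_le_trans /(_ (FTq T T_ge0)).
by move=> /lt_trans /(_ qa); rewrite ltxx.
Qed.

(** * Maps that are open at a point *)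

(** Pointwise form of openness, so that it can be established by induction
    along a single trajectory. *)
Definition open_at (X Y : topologicalType) (phi : X -> Y) (x : X) : Prop :=
  forall U, nbhs x U -> nbhs (phi x) (phi @` U).

Lemma open_at_comp (X Y Z : topologicalType) (phi : X -> Y) (psi : Y -> Z) x :
  open_at phi x -> open_at psi (phi x) -> open_at (psi \o phi) x.
Proof. by move=> ophi opsi U /ophi/opsi; rewrite /= -image_comp. Qed.

Lemma near_eq_open_at (X Y : topologicalType) (phi psi : X -> Y) x :
  (\forall y \near x, phi y = psi y) -> open_at phi x -> open_at psi x.
Proof.
move=> eq_phi ophi U xU.
rewrite -(nbhs_singleton eq_phi).
apply: filterS (ophi _ (filterI xU eq_phi)).
by move=> _ [y [Uy /= ->] <-]; exists y.
Qed.

(** Near [phi x] the image of U under phi contains the preimage of U under the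
    right inverse psi. *)
Lemma continuous_section_open_at (X Y : topologicalType) (phi : X -> Y)
    (psi : Y -> X) x :
  {for phi x, continuous psi} -> psi (phi x) = x ->
  (\forall y \near phi x, phi (psi y) = y) -> open_at phi x.
Proof.
move=> psic psiK phiK U xU.
have psiU : \forall y \near phi x, U (psi y) by apply: psic; rewrite psiK.
by apply: filterS2 psiU phiK => y Upsiy phipsiy; exists (psi y).
Qed.

(** To solve [phi x = y] for y near [phi z], put [G x = y - (phi x - x)], a
    contraction of a small closed ball A around z into itself. Its fixed point
    is obtained by minimizing the residue [|phi x - y| = |x - G x|] on the
    compact ball A: the residue of [G x] is at most half that of x, so the
    minimal residue is zero. *)
Lemma lipschitz_perturbation_open_at (R : realType) (n : nat)
    (phi : 'rV[R]_n -> 'rV[R]_n) (B : set 'rV[R]_n) :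
  (forall x y, B x -> B y ->
    `|(phi x - x) - (phi y - y)| <= 2^-1 * `|x - y|) ->
  forall z, nbhs z B -> open_at phi z.
Proof.
move=> phiB z zB U zU.
have [e /= e0 eUB] : exists2 e : R, 0 < e &
    forall x, `|z - x| <= e -> U x /\ B x.
  have [e eUB] := (nbhs_closedballP _ _).1 (filterI zU zB).
  exists e%:num => // x zx; apply: eUB.
  by rewrite closed_ballE.
have Bz : B z by exact: nbhs_singleton.
rewrite -nbhs_ballE; exists (e / 2) => /=; first by rewrite divr_gt0.
move=> y; rewrite -ball_normE /= => zy.
pose G x := y - (phi x - x).
pose A := [set x : 'rV[R]_n | `|z - x| <= e].
have GA x : A x -> A (G x).
  move=> Ax; rewrite /A /= /G.
  have [_ Bx] := eUB _ Ax.
  have -> : z - (y - (phi x - x)) = (phi z - y) - ((phi z - z) - (phi x - x)).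
    by rewrite !opprB; apply/rowP => i; rewrite !mxE; ring.
  rewrite (le_trans (ler_normB _ _))// (splitr e) lerD ?(ltW zy)//.
  by rewrite (le_trans (phiB _ _ Bz Bx))// mulrC ler_wpM2r// invr_ge0.
have Ac : compact A.
  have -> : A = closed_ball z e by rewrite closed_ballE.
  apply: bounded_closed_compact; last exact: closed_ball_closed.
  exists (`|z| + e); split; first by rewrite num_real.
  move=> M ltM x; rewrite closed_ballE //= => zx.
  rewrite -[x](subrK z) addrC (le_trans (ler_normD _ _))//.
  rewrite (le_trans _ (ltW ltM))//.
  by rewrite lerD2l distrC.
have contf : {within A, continuous (fun x => `|phi x - y|)}.
  apply/subspace_continuousP => x Ax.
  apply/cvgrPdist_lt => d d0.
  rewrite near_withinE; near=> x' => Ax'.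
  have [[_ Bx] [_ Bx']] := (eUB _ Ax, eUB _ Ax').
  rewrite (le_lt_trans (ler_dist_dist _ _))//.
  have -> : phi x - y - (phi x' - y) = ((phi x - x) - (phi x' - x')) + (x - x').
    by apply/rowP => i; rewrite !mxE; ring.
  rewrite (le_lt_trans (ler_normD _ _))//.
  rewrite (le_lt_trans (lerD (phiB _ _ Bx Bx') (lexx _)))//.
  have : `|x - x'| < d / 2.
    by near: x'; apply: cvgr_dist_lt => //; rewrite divr_gt0.
  lra.
have A0 : A !=set0 by exists z; rewrite /A /= subrr normr0 ltW.
have [x] := EVT_min_rV A0 Ac contf; rewrite inE => Ax /(_ (G x)).
rewrite inE => /(_ (GA _ Ax)) minx.
have [[Ux Bx] [_ BGx]] := (eUB _ Ax, eUB _ (GA _ Ax)).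
have := phiB _ _ BGx Bx.
have -> : phi (G x) - G x - (phi x - x) = phi (G x) - y.
  by rewrite {2}/G; apply/rowP => i; rewrite !mxE; ring.
have -> : G x - x = - (phi x - y).
  by rewrite /G; apply/rowP => i; rewrite !mxE; ring.
rewrite normrN => leG; exists x => //.
apply/eqP; rewrite -subr_eq0 -normr_eq0.
have := normr_ge0 (phi x - y) => ge0; apply/eqP; lra.
Unshelve. all: by end_near. Qed.

(** * C^1 families of maps close to the identity *)

Lemma coord_le_norm (R : realType) (n : nat) (v : 'rV[R]_n) j :
  `|v 0 j| <= `|v|.
Proof.
by rewrite [leRHS]/Num.Def.normr/= mx_normrE; exact: (le_bigmax _ _ (0, j)).
Qed.

Lemma norm_le_coord (R : realType) (n : nat) (v : 'rV[R]_n) (e : R) :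
  0 <= e -> (forall j, `|v 0 j| <= e) -> `|v| <= e.
Proof.
move=> e0 ve; rewrite /Num.Def.normr/= mx_normrE.
rewrite (bigmax_le _ e0)//= => -[i j] _ /=.
by rewrite ord1.
Qed.

Lemma is_derive_along_line (R : realType) (V : normedModType R) (n : nat)
    (h : V -> 'rV[R]_n) (z v : V) (u : R) j :
  differentiable h (u *: v + z) ->
  is_derive u 1 (fun u => h (u *: v + z) 0 j) ('D_v h (u *: v + z) 0 j).
Proof.
move=> dh; have dhv := diff_derivable (v := v) dh.
have quotE (W : normedModType R) (k : V -> W) :
  (fun t : R => t^-1 *: (k ((t *: (1 : R) + u) *: v + z) - k (u *: v + z))) =
  (fun t : R => t^-1 *: (k (t *: v + (u *: v + z)) - k (u *: v + z))).
  by apply/funext => t; rewrite scalerDl addrA [t *: 1]mulr1.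
split.
  have /derivable_mxP/(_ 0 j) := dhv.
  by rewrite /derivable (quotE _ (fun w => h w 0 j)).
rewrite derive_mx// mxE /derive.
by rewrite (quotE _ (fun w => h w 0 j)).
Qed.

(** The mean value theorem fails for vector-valued maps, but it applies to each
    coordinate, and the norm of ['rV[R]_n] is the maximum of the coordinates. *)
Lemma segment_increment_le (R : realType) (n : nat) (V : normedModType R)
    (h : V -> 'rV[R]_n) (z v : V) (w : 'rV[R]_n) (e : R) :
  0 <= e ->
  (forall u : R, 0 <= u <= 1 -> differentiable h (u *: v + z)) ->
  (forall u : R, 0 <= u <= 1 -> `|'D_v h (u *: v + z) - w| <= e) ->
  `|h (v + z) - h z - w| <= e.
Proof.
move=> e0 dh Dh; apply: norm_le_coord => // j.
have dj (u : R) : 0 <= u <= 1 ->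
    is_derive u 1 (fun u => h (u *: v + z) 0 j) ('D_v h (u *: v + z) 0 j).
  by move=> u01; apply: is_derive_along_line; exact: dh.
have [||c] := @MVT_segment _ (fun u => h (u *: v + z) 0 j)
  (fun u => 'D_v h (u *: v + z) 0 j) 0 1 ler01.
- by move=> u; rewrite in_itv /= => /andP[u0 u1]; apply: dj; rewrite !ltW.
- apply: derivable_within_continuous => u; rewrite in_itv /= => u01.
  by have := dj u u01 => ?; exact: ex_derive.
rewrite in_itv /= => c01; rewrite scale1r scale0r add0r subr0 mulr1 => hE.
have -> : (h (v + z) - h z - w) 0 j = ('D_v h (c *: v + z) - w) 0 j.
  by rewrite !mxE -hE.
exact: le_trans (coord_le_norm _ _) (Dh _ c01).
Qed.

(** At (0, x0) the derivative of h in a direction (0, w) is w, and by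
    continuity nearly so at neighbouring points. Integrating along a segment in
    one slice [h (s, _)] bounds the variation of [h (s, _) - id]. *)
Lemma identity_slice_near_lipschitz (R : realType) (n : nat)
    (U : set (R * 'rV[R]_n)) (h : R * 'rV[R]_n -> 'rV[R]_n) (x0 : 'rV[R]_n) :
  open_nbhs (0, x0) U -> Ck 1 U h -> (\forall x \near x0, h (0, x) = x) ->
  exists2 r : R, 0 < r & forall s, `|s| < r ->
    forall x y, ball x0 r x -> ball x0 r y ->
      `|(h (s, x) - x) - (h (s, y) - y)| <= 2^-1 * `|x - y|.
Proof.
move=> [U_open Ux0] [dh dhc] h0.
pose vert (w : 'rV[R]_n) : R * 'rV[R]_n := (0, w).
have DhE w : 'D_(vert w) h (0, x0) = w.
  rewrite /derive; apply: cvg_lim => //; apply: cvg_near_cst.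
  have lin0 : (fun t : R => t *: w + x0) t @[t --> (0 : R)] --> x0.
    rewrite -[X in _ --> X]add0r -(scale0r w).
    by apply: cvgD; [apply: cvgZr_tmp; exact: cvg_id|exact: cvg_cst].
  have : \forall t \near (0 : R), h (0, t *: w + x0) = t *: w + x0.
    exact: lin0 h0.
  move=> /nbhs_dnbhs ht; near=> t.
  have t0 : t != 0 by near: t; exact: nbhs_dnbhs_neq.
  change (t^-1 *: (h (t *: vert w + (0, x0)) - h (0, x0)) = w).
  have -> : t *: vert w + (0, x0) = (0, t *: w + x0).
    by apply: injective_projections => //=; rewrite scaler0 addr0.
  rewrite (near ht t)// (nbhs_singleton h0) addrK scalerA mulVf//.
  by rewrite scale1r.
(* small enough for the errors in the n basis directions to add up to at most
   1/2; the successor covers dimension 0 *)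
pose e : R := (2 * n.+1%:R)^-1.
have e0 : 0 < e by rewrite invr_gt0 mulr_gt0.
have near_vert : \forall z \near ((0, x0) : R * 'rV[R]_n), U z /\
    forall i : 'I_n, `|'D_(vert (delta_mx 0 i)) h z - delta_mx 0 i| <= e.
  have Dh_near : \forall z \near ((0, x0) : R * 'rV[R]_n),
      forall i : 'I_n, `|'D_(vert (delta_mx 0 i)) h z - delta_mx 0 i| <= e.
    apply: (@filter_forall _ _ (fun i => [set z |
      `|'D_(vert (delta_mx 0 i)) h z - delta_mx 0 i| <= e]) _ (nbhs_filter _))
      => i.
    have /cvgrPdist_le/(_ e e0) := dhc (vert (delta_mx 0 i)) _ Ux0.
    by rewrite DhE; apply: filterS => z; rewrite distrC.
  by apply: filterS2 (open_nbhs_nbhs (conj U_open Ux0)) Dh_near.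
have [r /= r0 near_r] := (nbhs_ballP _ _).1 near_vert.
exists r => // s s_r x y x_r y_r.
have ball_r (u : R) : 0 <= u <= 1 ->
    ball ((0, x0) : R * 'rV[R]_n) r (u *: vert (x - y) + (s, y)).
  move=> u01; split => /=.
    by rewrite scaler0 add0r /ball /= sub0r normrN.
  have := x_r; have := y_r; rewrite -ball_normE /= => yr xr.
  have -> : x0 - (u *: (x - y) + y) = u *: (x0 - x) + (1 - u) *: (x0 - y).
    by apply/rowP => i; rewrite !mxE; ring.
  have [u0 u1] := andP u01.
  have [m [xm ym mr]] : exists m, [/\ `|x0 - x| <= m, `|x0 - y| <= m & m < r].
    exists (Num.max `|x0 - x| `|x0 - y|).
    by rewrite !le_max !lexx orbT gt_max xr yr.
  apply: le_lt_trans mr; rewrite (le_trans (ler_normD _ _))// !normrZ.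
  by rewrite (ger0_norm u0) ger0_norm ?subr_ge0//; nra.
have := @segment_increment_le R n _ h (s, y) (vert (x - y)) (x - y)
  (2^-1 * `|x - y|).
have -> : vert (x - y) + (s, y) = (s, x).
  by apply: injective_projections => //=; rewrite ?add0r ?subrK.
have -> : h (s, x) - h (s, y) - (x - y) = h (s, x) - x - (h (s, y) - y).
  by apply/rowP => i; rewrite !mxE; ring.
apply.
- by rewrite mulr_ge0 // invr_ge0.
- by move=> u /ball_r/near_r[Uu _]; exact: dh.
move=> u /ball_r/near_r[/dh dhu Dhu].
set z := _ + _ in dhu Dhu *.
have vertE : vert (x - y) = \sum_(i < n) (x - y) 0 i *: vert (delta_mx 0 i).
  apply: injective_projections => /=.
    rewrite (big_morph fst (id1 := 0) (op1 := +%R)) //= big1 // => i _.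
    by rewrite scaler0.
  rewrite (big_morph snd (id1 := 0) (op1 := +%R)) //=.
  exact: row_sum_delta.
rewrite deriveE // {1}vertE linear_sum [X in _ - X]row_sum_delta -sumrB.
rewrite (le_trans (ler_norm_sum _ _ _))//.
apply: (@le_trans _ _ (\sum_(i < n) `|x - y| * e)).
  apply: ler_sum => i _.
  rewrite linearZ -scalerBr normrZ ler_pM //; first exact: coord_le_norm.
  by rewrite -deriveE.
rewrite sumr_const card_ord -mulrnAr mulrC ler_wpM2r //.
rewrite /e -mulr_natr invfM -mulrA ger_pMr ?invr_gt0 // mulrC ler_pdivrMr //.
by rewrite mul1r ler_nat.
Unshelve. all: by end_near. Qed.

(** * Openness of the time maps of a semiflow *)

Lemma chart_coord_continuous (R : realType) (n : nat) (M : topologicalType)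
    (c : chart R n M) q : dom c q -> {for q, continuous (coord c)}.
Proof.
move=> cq; have := coord_continuous (c := c).
rewrite continuous_open_subspace; last exact: dom_open.
by apply; rewrite inE.
Qed.

Lemma chart_param_continuous (R : realType) (n : nat) (M : topologicalType)
    (c : chart R n M) y : chart_img c y -> {for y, continuous (param c)}.
Proof.
move=> cy; have := param_continuous (c := c).
rewrite continuous_open_subspace; last exact: chart_img_open.
by apply; rewrite inE.
Qed.

Lemma chart_coord_open_at (R : realType) (n : nat) (M : topologicalType)
    (c : chart R n M) q : dom c q -> open_at (coord c) q.
Proof.
move=> cq; have icq : chart_img c (coord c q) by exists q.
have img_nbhs : nbhs (coord c q) (chart_img c).
  by apply: open_nbhs_nbhs; split => //; exact: chart_img_open.
apply: (@continuous_section_open_at _ _ _ (param c)).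
- exact: chart_param_continuous.
- exact: coordK.
- by apply: filterS img_nbhs => _ [q' cq' <-]; rewrite coordK.
Qed.

Lemma chart_param_open_at (R : realType) (n : nat) (M : topologicalType)
    (c : chart R n M) y : chart_img c y -> open_at (param c) y.
Proof.
move=> [q cq <-].
have dom_nbhs : nbhs q (dom c).
  by apply: open_nbhs_nbhs; split => //; exact: dom_open.
apply: (@continuous_section_open_at _ _ _ (coord c)); rewrite coordK //.
- exact: chart_coord_continuous.
- by apply: filterS dom_nbhs => q' cq'; rewrite coordK.
Qed.

(** Read in one chart around p, the time maps of the flow for short times are
    close to the identity, hence open at the points near p. That N and d serve
    all s and q at once is what allows composing along a trajectory. *)
Lemma semiflow_open_at_small_time (R : realType) (n : nat)
    (M : topologicalType) (S : smooth_structure R n M) (Phi : R -> M -> M) :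
  smooth_semiflow_map S Phi -> (forall p, Phi 0 p = p) ->
  forall p : M, exists2 N : set M, nbhs p N & exists2 d : R, 0 < d &
    forall s q, 0 <= s < d -> N q -> open_at (Phi s) q.
Proof.
move=> [Phi_cont Phi_smooth] Phi0 p.
have [c [Sc cp]] := atlas_cover S p.
pose x0 := coord c p.
have c_x0 : chart_img c x0 by exists p.
have img_nbhs : nbhs x0 (chart_img c).
  by apply: open_nbhs_nbhs; split => //; exact: chart_img_open.
have A0 : [/\ 0 <= (0 : R), chart_img c x0 & dom c (Phi 0 (param c x0))].
  by split => //; rewrite coordK // Phi0.
have [U [h [U0 h_smooth hE]]] := Phi_smooth c c Sc Sc (0, x0) A0.
(* one chart c serves at both ends of the short trajectories near p *)
have dom_near : \forall z \near ((0, x0) : R * 'rV[R]_n),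
    0 <= z.1 -> dom c (Phi z.1 (param c z.2)).
  have Phi_cvg := (subspace_continuousP _ _).1 Phi_cont (0, p) (lexx 0).
  have dom_near : \forall z \near ((0, p) : R * M),
      0 <= z.1 -> dom c (Phi z.1 z.2).
    apply: Phi_cvg; rewrite /from_subspace /= Phi0.
    by apply: open_nbhs_nbhs; split => //; exact: dom_open.
  have [[I V] [/= I0 Vp] IV] := dom_near.
  exists (I, param c @^-1` V); last first.
    by move=> [s x] [/= Is Vx]; exact: (IV (s, param c x)).
  split => //=; have param_cont := chart_param_continuous c_x0.
  by apply: (param_cont V _); rewrite coordK.
have img_near : \forall z \near ((0, x0) : R * 'rV[R]_n), chart_img c z.2.
  by exists (setT, chart_img c); [split => //=; exact: filterT|case=> s x []].
have h0 : \forall x \near x0, h (0, x) = x.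
  have : \forall x \near x0, U (0, x).
    have [[I V] [/= I0 Vx0] IV] := open_nbhs_nbhs U0.
    apply: filterS Vx0 => x Vx; apply: (IV (0, x)).
    by split => //=; exact: nbhs_singleton.
  apply: filterS2 img_nbhs => x [q cq <-] U0q.
  rewrite -hE //=; rewrite coordK // Phi0 //.
  by split => //; exists q.
have [r r0 h_lip] := identity_slice_near_lipschitz U0 (h_smooth 1%N) h0.
have [r' /= r'0 near_r'] := (nbhs_ballP _ _).1
  (filterI (open_nbhs_nbhs U0) (filterI dom_near img_near)).
exists (dom c `&` coord c @^-1` (ball x0 (Num.min r r'))).
  apply: filterI; first by apply: open_nbhs_nbhs; split => //; exact: dom_open.
  apply: chart_coord_continuous => //.
  by apply: nbhsx_ballx; rewrite lt_min r0.
exists (Num.min r r'); first by rewrite lt_min r0.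
move=> s q /andP[s0]; rewrite lt_min => /andP[sr sr'] [cq xq].
have s_norm : `|s| < r by rewrite ger0_norm.
have chartE x : ball x0 (Num.min r r') x ->
    [/\ dom c (Phi s (param c x)), h (s, x) = coord c (Phi s (param c x))
     & chart_img c x].
  move=> x_r; have sx_r' : ball ((0, x0) : R * 'rV[R]_n) r' (s, x).
    split; first by rewrite /ball /= sub0r normrN ger0_norm.
    by apply: le_ball x_r; rewrite ge_min lexx orbT.
  have [Usx [/(_ s0) /= dom_sx img_x]] := near_r' _ sx_r'.
  by split => //; rewrite -hE.
have nbhs_q : \forall q' \near q,
    dom c q' /\ ball x0 (Num.min r r') (coord c q').
  apply: filterI; first by apply: open_nbhs_nbhs; split => //; exact: dom_open.
  apply: chart_coord_continuous => //.
  by apply: open_nbhs_nbhs; split => //; exact: ball_open.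
have [domq hq _] := chartE _ xq.
apply: (@near_eq_open_at _ _ (param c \o (fun x => h (s, x)) \o coord c)).
  apply: filterS nbhs_q => q' [cq' xq'] /=.
  by have [dq' -> _] := chartE _ xq'; rewrite (coordK dq') (coordK cq').
apply: open_at_comp; first exact: chart_coord_open_at.
apply: open_at_comp.
  apply: (@lipschitz_perturbation_open_at _ _ _ (ball x0 (Num.min r r'))).
    move=> x y x_r y_r; apply: h_lip => //.
    - by apply: le_ball x_r; rewrite ge_min lexx.
    - by apply: le_ball y_r; rewrite ge_min lexx.
  by apply: open_nbhs_nbhs; split => //; exact: ball_open.
by apply: chart_param_open_at; rewrite /= hq; exact: imageP.
Qed.

(** Let m be the supremum of the times up to t at which the time map is open at
    q. Around [Phi m q] short time maps are open by a uniform amount, so a good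
    time s just before m propagates beyond m unless t is reached. *)
Lemma semiflow_open_at (R : realType) (n : nat) (M : topologicalType)
    (S : smooth_structure R n M) (Phi : R -> M -> M) :
  smooth_injective_semiflow S Phi ->
  forall t p, 0 <= t -> open_at (Phi t) p.
Proof.
move=> [Phi_smooth Phi0 PhiD _] t q t0.
pose A := [set s | 0 <= s <= t /\ open_at (Phi s) q].
have A0 : A 0.
  split; first by rewrite lexx.
  apply: (@near_eq_open_at _ _ id); last by move=> U; rewrite image_id.
  by apply: nearW => x; rewrite Phi0.
have A_sup : has_sup A.
  by split; [exists 0|exists t => s [/andP[]]].
pose m := sup A.
have m0 : 0 <= m by apply: sup_upper_bound.
have [N mN [d d0 openN]] :=
  semiflow_open_at_small_time Phi_smooth Phi0 (Phi m q).
have [e e0 eN] : exists2 e : R, 0 < e &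
    forall s, 0 <= s -> `|m - s| < e -> N (Phi s q).
  have Phi_cvg := (subspace_continuousP _ _).1 Phi_smooth.1 (m, q) m0.
  have near_mq : \forall z \near ((m, q) : R * M), 0 <= z.1 -> N (Phi z.1 z.2).
    exact: Phi_cvg.
  have [[I V] [/= /nbhs_ballP[e /= e0 eI] Vq] IV] := near_mq.
  exists e => // s s0 ms; apply: (IV (s, q)) => //.
  by split => /=; [exact: eI|exact: nbhs_singleton].
have [k k0 [ke kd]] : exists2 k : R, 0 < k & k <= e /\ k <= d / 2.
  exists (Num.min e (d / 2)); first by rewrite lt_min e0 divr_gt0.
  by rewrite !ge_min !lexx orbT.
have [s [/andP[s0 st] open_s] sm] := sup_adherent k0 A_sup.
have s_le_m : s <= m by apply: sup_upper_bound => //; split => //; rewrite s0.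
pose s' := Num.min t (m + d / 2).
have s'E : s' <= m + d / 2 by rewrite ge_min lexx orbT.
have ss' : s <= s' by rewrite le_min st; lra.
have As' : A s'.
  split; first by rewrite (le_trans s0 ss') ge_min lexx.
  apply: (@near_eq_open_at _ _ (Phi (s' - s) \o Phi s)).
    by apply: nearW => x /=; rewrite -PhiD ?subr_ge0 // subrK.
  apply: open_at_comp => //; apply: openN; last first.
    apply: eN => //; rewrite ger0_norm ?subr_ge0 //.
    by move: sm; rewrite -/m; lra.
  by rewrite subr_ge0 ss' /=; move: sm; rewrite -/m; lra.
have : s' <= m by exact: sup_upper_bound.
rewrite ge_min => /orP[tm|]; last lra.
suff -> : t = s' by case: As'.
by rewrite /s' min_l //; lra.
Qed.

(** For t < 0 injectivity of the flow shows that p lies in the domain only if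
    it is in the image of the open map [Phi (- t)]. *)
Lemma space_domain_open (R : realType) (n : nat) (M : topologicalType)
    (S : smooth_structure R n M) (Phi : R -> M -> M) :
  smooth_injective_semiflow S Phi -> forall t, open (space_domain Phi t).
Proof.
move=> Phi_flow t; have [_ Phi0 PhiD Phi_inj] := Phi_flow.
rewrite openE => p [s [u [p' [s0 u0 pE tE]]]].
have [t0|t_lt0] := leP 0 t.
  by apply: nearW => q; exists t, 0, (Phi t q); rewrite Phi0 subr0.
have Nt0 : 0 <= - t by rewrite oppr_ge0 ltW.
have pE' : Phi (- t) p' = p.
  apply: (Phi_inj s s0); rewrite -PhiD // -pE; congr (Phi _ _); lra.
have image_nbhs : nbhs p (Phi (- t) @` setT).
  rewrite -[in X in nbhs X _]pE'.
  exact: (semiflow_open_at Phi_flow Nt0 filterT).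
apply: filterS image_nbhs => _ [q _ <-].
by exists 0, (- t), q; rewrite Phi0 sub0r opprK.
Qed.

(** * Suprema along trajectories *)

Theorem theorem9 (R : realType) (n : nat) (M : topologicalType)
    (S : smooth_structure R n M) (g : riemannian_metric S)
    (g_complete : riemannian_complete g)
    (K : set M) (K_nonempty : K !=set0) (K_compact : compact K)
    (Phi : R -> M -> M) (Phi_semiflow : smooth_injective_semiflow S Phi)
    (f : R -> M -> \bar R)
    (f_ge0 : forall t p, space_domain Phi t p -> (0 <= f t p)%E)
    (f_lsc : forall t,
       @lower_semicontinuous (subspace (space_domain Phi t)) R (f t)) :
  forall F : R -> M -> \bar R,
    [\/ F = F_plus Phi f, F = F_minus Phi f | F = F_plusminus Phi f] ->
    [/\ (forall (T : R) (p : M), 0 <= T -> (0 <= F T p)%E),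
        (forall T : R, 0 <= T -> lower_semicontinuous (F T)),
        (forall (T T' : R) (p : M), 0 <= T -> T <= T' -> (F T p <= F T' p)%E),
        (forall T : R, 0 <= T -> exists p, min_point K (F T) p) &
        (forall x : R -> M,
           (forall T : R, 0 <= T -> min_point K (F T) (x T)) ->
           exists p, min_point K (sup_over_T F) p /\ accumulation_point x p)].
Proof.
move=> F F_cases.
(* the three cases differ only in the interval of times *)
have [J [FE J0 Jmono]] : exists J : R -> set R,
    [/\ F = (fun T p => ereal_sup [set f t p | t in J T `&` time_domain Phi p]),
        forall T, 0 <= T -> J T 0 &
        forall T T', 0 <= T -> T <= T' -> J T `<=` J T'].
  case: F_cases => ->.
  - exists (fun T => `[0, T]%classic); split => //= [T T0|T T' T0 TT' t /=].
      by rewrite in_itv /= lexx.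
    by rewrite !in_itv /= => /andP[-> /le_trans]; exact.
  - exists (fun T => `[- T, 0]%classic); split => //= [T T0|T T' T0 TT' t /=].
      by rewrite in_itv /= lexx oppr_le0 T0.
    rewrite !in_itv /= => /andP[tT ->]; rewrite andbT; lra.
  - exists (fun T => `[- T, T]%classic); split => //= [T T0|T T' T0 TT' t /=].
      by rewrite in_itv /= oppr_le0 T0.
    rewrite !in_itv /= => /andP[? ?]; apply/andP; split; lra.
have F0 T p : 0 <= T -> (0 <= F T p)%E.
  have Dp0 : time_domain Phi p 0.
    by exists 0, 0, p; rewrite subr0.
  move=> T0; rewrite FE; apply: le_trans (f_ge0 0 p Dp0) _.
  by apply: ereal_sup_ubound; exists 0 => //; split => //; exact: J0.
have Flsc T : 0 <= T -> lower_semicontinuous (F T).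
  move=> _; rewrite FE.
  exact: lower_semicontinuous_sup (space_domain_open Phi_semiflow) f_lsc.
have Fmono T T' p : 0 <= T -> T <= T' -> (F T p <= F T' p)%E.
  move=> T0 TT'; rewrite FE; apply: le_ereal_sup => _ [t [Jt Dt] <-].
  by exists t => //; split => //; exact: Jmono Jt.
split => //.
- move=> T T0; apply: lower_semicontinuous_min => // [|p]; first exact: Flsc.
  exact: F0.
- by move=> x; exact: min_point_sup_accumulation.
Qed.
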